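(* Let $n\ge1$ and $\xi\in\mathcal{F}^2_n$. Then $W_\xi$ is an isometry if and only if \[ \xi=\sum_{p=0}^\infty c_pe_1^{\otimes p}, \] where $\{c_p\}_{p\ge0}$ is a sequence of scalars with $\sum_{p=0}^\infty|c_p|^2=1$ and $\sum_{p=0}^\infty c_{p+r}\overline{c_p}=0$ for all $r\ge1$.
   Context: $F_n^+$ is the free semigroup on letters $g_1,\dots,g_n$ with identity $g_0$. The Fock space is the complex Hilbert space $\mathcal{F}^2_n=\mathbb{C}\Omega\oplus\bigoplus_{k\ge1}(\mathbb{C}^n)^{\otimes k}$ with vacuum unit vector $\Omega$; $\{e_1,\dots,e_n\}$ is the standard orthonormal basis of $\mathbb{C}^n$; $e_\mu=e_{\mu_1}\otimes\cdots\otimes e_{\mu_k}$ for $\mu=g_{\mu_1}\cdots g_{\mu_k}$ and $e_{g_0}=\Omega=e_1^{\otimes0}$; the $e_\mu$ form an orthonormal basis of $\mathcal{F}^2_n$. $\mathcal{B}(\mathcal{F}^2_n)$ is the space of bounded linear operators on $\mathcal{F}^2_n$. Scalar odometer map: for $\xi\in\mathcal{F}^2_n$, the odometer map with symbol $\xi$ is the operator $W_\xi\in\mathcal{B}(\mathcal{F}^2_n)$ defined by $W_\xi\Omega=\xi$; $W_\xi(e_n^{\otimes m})=e_1^{\otimes m}\otimes\xi$ for $m\ge1$; and $W_\xi(e_n^{\otimes j}\otimes e_i\otimes e_\nu)=e_1^{\otimes j}\otimes e_{i+1}\otimes e_\nu$ for $j\ge0$, $1\le i\le n-1$, $\nu\in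 F_n^+$ (tensor factors equal to $\Omega$ next to other factors are dropped). *)

(* Defs.v *)
From HB Require Import structures.
From mathcomp Require Import all_boot all_order all_algebra.
From mathcomp Require Import complex.
From mathcomp Require Import ring lra.
From mathcomp Require Import all_classical all_reals all_analysis.

Set Implicit Arguments.
Unset Strict Implicit.
Unset Printing Implicit Defensive.

Import Order.TTheory GRing.Theory Num.Theory.
Import numFieldNormedType.Exports.
Import Normc.

Local Open Scope classical_set_scope.
Local Open Scope ring_scope.

(* The free semigroup on n letters; the letter g_i is (i - 1) : 'I_n, the
   identity is [::] and the product is concatenation. *)
Definition word (n : nat) := seq 'I_n.

(* Coordinates of a vector on the orthonormal basis (e_w) indexed by words. *)
Definition sqnorm (R : realType) (n : nat) (f : word n -> R[i]) : \bar R :=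
  \esum_(w in [set: word n]) ((normc (f w) ^+ 2)%:E).

Definition square_summable (R : realType) (n : nat) :
  {pred (word n -> R[i])} := [pred f | `[< (sqnorm f < +oo)%E >]].

Section square_summable_theory.
Context {R : realType} {n : nat}.
Implicit Types f g : word n -> R[i].

Lemma sqnorm_ge0 f : (0 <= sqnorm f)%E.
Proof. by apply: esum_ge0 => w _; rewrite lee_fin sqr_ge0. Qed.

Lemma square_summableP f :
  reflect (sqnorm f < +oo)%E (f \in @square_summable R n).
Proof. exact: asboolP. Qed.

Lemma sqnorm_fin f :
  f \in @square_summable R n -> (fine (sqnorm f))%:E = sqnorm f.
Proof.
by move=> /square_summableP fl; rewrite fineK// ge0_fin_numE// sqnorm_ge0.
Qed.

Lemma esum_mull (a : word n -> \bar R) (k : R) : 0 <= k ->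
  (forall w, (0 <= a w)%E) ->
  (\esum_(w in [set: word n]) (k%:E * a w) <=
   k%:E * \esum_(w in [set: word n]) a w)%E.
Proof.
move=> k0 a0; apply: ge_ereal_sup => _ [A fA <-].
rewrite -ge0_mule_fsumr//; apply: lee_wpmul2l; first by rewrite lee_fin.
by apply: ereal_sup_ubound; exists A.
Qed.

Lemma sqnormZ_le (k : R[i]) f :
  (sqnorm (k *: f)%R <= (normc k ^+ 2)%:E * sqnorm f)%E.
Proof.
apply: (@le_trans _ _ (\esum_(w in [set: word n])
    ((normc k ^+ 2)%:E * (normc (f w) ^+ 2)%:E)%E)).
  by apply: le_esum => w _; rewrite -EFinM -exprMn -normcM.
by apply: esum_mull; rewrite ?sqr_ge0// => w; rewrite lee_fin sqr_ge0.
Qed.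

Lemma normc_add (x y : R[i]) : normc (x + y) <= normc x + normc y.
Proof.
have : (normc (x + y))%:C%C <= (normc x)%:C%C + (normc y)%:C%C := ler_normD x y.
by rewrite -rmorphD lecR.
Qed.

Lemma normc_nneg (x : R[i]) : 0 <= normc x.
Proof. by case: x => a b; exact: sqrtr_ge0. Qed.

Lemma sqnormD_le f g (s : R) : 0 < s ->
  (sqnorm (f + g)%R <= (1 + s)%R%:E * sqnorm f + (1 + s^-1)%R%:E * sqnorm g)%E.
Proof.
move=> s0; have sV0 : 0 < s^-1 by rewrite invr_gt0.
apply: (@le_trans _ _ (\esum_(w in [set: word n])
    ((1 + s)%R%:E * (normc (f w) ^+ 2)%:E +
     (1 + s^-1)%R%:E * (normc (g w) ^+ 2)%:E)%E)).
  apply: le_esum => w _; rewrite -!EFinM -EFinD lee_fin.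
  apply: (@le_trans _ _ ((normc (f w) + normc (g w)) ^+ 2)).
    rewrite ler_pXn2r// ?nnegrE ?addr_ge0 ?normc_nneg//.
    exact: normc_add.
  set a := normc _; set b := normc _; rewrite -subr_ge0.
  rewrite (_ : _ - _ = (s * a - b) ^+ 2 * s^-1); last by field; rewrite gt_eqF.
  by rewrite mulr_ge0 ?sqr_ge0// ltW.
rewrite esumD; last 2 first.
- by move=> w _; rewrite -EFinM lee_fin mulr_ge0 ?sqr_ge0// addr_ge0 ?ltW.
- by move=> w _; rewrite -EFinM lee_fin mulr_ge0 ?sqr_ge0// addr_ge0 ?ltW.
apply: leeD; apply: esum_mull => [|w]; rewrite ?lee_fin ?sqr_ge0//.
- by rewrite addr_ge0 ?ltW.
- by rewrite addr_ge0 ?ltW.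
Qed.

Lemma coord_le_sqnorm f (w : word n) : ((normc (f w) ^+ 2)%:E <= sqnorm f)%E.
Proof.
apply: esum_ge; exists [set w]; first by split=> //; exact: finite_set1.
by rewrite fsbig_set1.
Qed.

Lemma sqnorm0 : sqnorm (0 : word n -> R[i]) = 0%E.
Proof.
by apply: esum1 => w _; rewrite (_ : normc _ = 0) ?expr0n//; exact: normc0.
Qed.

Lemma sqnorm_eq0 f : sqnorm f = 0%E -> f = 0.
Proof.
move=> f0; apply/funext => w; apply: eq0_normc; apply/eqP.
rewrite -sqrf_eq0 eq_le sqr_ge0 andbT -lee_fin -[X in (_ <= X)%E]f0.
exact: coord_le_sqnorm.
Qed.

Lemma square_summable_submod : submod_closed (@square_summable R n).
Proof.
split; first by apply/square_summableP; rewrite sqnorm0 ltry.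
move=> k f g fl gl; apply/square_summableP.
apply: le_lt_trans (sqnormD_le _ _ ltr01) _.
rewrite -(sqnorm_fin gl) -EFinM; apply: lte_add_pinfty; last exact: ltry.
apply: le_lt_trans (_ : _ <= (1 + 1)%R%:E * ((normc k ^+ 2)%:E * sqnorm f))%E _.
  apply: lee_wpmul2l (sqnormZ_le _ _).
  by rewrite lee_fin.
by rewrite -(sqnorm_fin fl) -!EFinM ltry.
Qed.

HB.instance Definition _ :=
  GRing.isSubmodClosed.Build _ _ (@square_summable R n) square_summable_submod.

End square_summable_theory.

(* The full Fock space of C^n, realized as l^2 of the free semigroup through
   its orthonormal basis (e_w). *)
Record fock (R : realType) (n : nat) := Fock {
  coord :> word n -> R[i];
  coordP : coord \in @square_summable R n }.

Section fock_space.
Context (R : realType) (n : nat).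

HB.instance Definition _ := [isSub for @coord R n].
HB.instance Definition _ := [Choice of fock R n by <:].
HB.instance Definition _ := [SubChoice_isSubLmodule of fock R n by <:].

Definition fock_norm (f : fock R n) : R[i] := (Num.sqrt (fine (sqnorm f)))%:C%C.

Lemma sqnorm_sqrt (f : fock R n) :
  sqnorm f = ((Num.sqrt (fine (sqnorm f))) ^+ 2)%:E.
Proof.
by rewrite sqr_sqrtr ?sqnorm_fin ?coordP// fine_ge0// sqnorm_ge0.
Qed.

Lemma fock_norm0_eq0 (f : fock R n) : fock_norm f = 0 -> f = 0.
Proof.
move=> /complexI f0; apply/val_inj/sqnorm_eq0.
by rewrite sqnorm_sqrt f0 expr0n.
Qed.

Lemma fock_normD (f g : fock R n) :
  fock_norm (f + g) <= fock_norm f + fock_norm g.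
Proof.
rewrite /fock_norm -rmorphD lecR.
have [f0|fn0] := eqVneq (Num.sqrt (fine (sqnorm f))) 0.
  by rewrite f0 (fock_norm0_eq0 (congr1 (real_complex R) f0)) !add0r.
have [g0|gn0] := eqVneq (Num.sqrt (fine (sqnorm g))) 0.
  by rewrite g0 (fock_norm0_eq0 (congr1 (real_complex R) g0)) !addr0.
have a0 : 0 < Num.sqrt (fine (sqnorm f)) by rewrite lt0r fn0 sqrtr_ge0.
have b0 : 0 < Num.sqrt (fine (sqnorm g)) by rewrite lt0r gn0 sqrtr_ge0.
rewrite -(@ler_pXn2r _ 2)// ?nnegrE ?addr_ge0 ?sqrtr_ge0// -lee_fin -sqnorm_sqrt.
have := sqnorm_sqrt g; have := sqnorm_sqrt f; move: fn0 gn0 a0 b0.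
move: (Num.sqrt (fine (sqnorm f))) (Num.sqrt (fine (sqnorm g))).
move=> a b an0 bn0 a0 b0 fE gE.
apply: le_trans (sqnormD_le _ _ (divr_gt0 b0 a0)) _.
rewrite fE gE -!EFinM -EFinD lee_fin le_eqVlt; apply/orP; left; apply/eqP.
by field; rewrite an0 bn0.
Qed.

Lemma fock_normZ_le (k : R[i]) (f : fock R n) :
  fock_norm (k *: f) <= `|k| * fock_norm f.
Proof.
rewrite -[`|k|]/((normc k)%:C%C) /fock_norm -rmorphM lecR.
rewrite -(@ler_pXn2r _ 2)// ?nnegrE ?mulr_ge0 ?normc_nneg ?sqrtr_ge0//.
rewrite -lee_fin -sqnorm_sqrt exprMn EFinM -sqnorm_sqrt.
exact: sqnormZ_le.
Qed.

Lemma fock_normZ (k : R[i]) (f : fock R n) :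
  fock_norm (k *: f) = `|k| * fock_norm f.
Proof.
apply/eqP; rewrite eq_le fock_normZ_le /=.
have [->|k0] := eqVneq k 0.
  by rewrite normr0 mul0r /fock_norm ler0c sqrtr_ge0.
rewrite -ler_pdivlMl ?normr_gt0// -normfV.
by rewrite -[f in leLHS](scalerK k0); exact: fock_normZ_le.
Qed.

HB.instance Definition _ :=
  Lmodule_isNormed.Build R[i] (fock R n) fock_normD fock_normZ fock_norm0_eq0.

End fock_space.

Section fock_vectors.
Context {R : realType} {n : nat}.
Implicit Types (w v : word n) (xi : fock R n).

Lemma basis_subproof w :
  (fun v : word n => (v == w)%:R : R[i]) \in @square_summable R n.
Proof.
apply/square_summableP.
rewrite (_ : sqnorm _ = 1%E) ?ltry// /sqnorm.
rewrite -(@esum_set1 R _ w (fun=> 1%E))// [RHS]esum_mkcond.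
apply: eq_esum => v _; case: eqP => vw.
  by rewrite normc1 expr1n ifT//; exact/mem_set.
by rewrite normc0 expr0n ifF//; apply/negbTE/negP => /set_mem.
Qed.

(* The vector e_w; the vacuum vector is fock_basis [::], and the m-th tensor
   power of the letter i is fock_basis (nseq m i). *)
Definition fock_basis w : fock R n := Fock (basis_subproof w).

Lemma tensor_subproof w xi :
  (fun v => if prefix w v then xi (drop (size w) v) else 0)
    \in @square_summable R n.
Proof.
apply/square_summableP.
rewrite (_ : sqnorm _ = sqnorm xi) ?(square_summableP _ (coordP xi))//.
have cat_inj : set_inj [set: word n] (cat w).
  by move=> u v _ _ /eqP; rewrite eqseq_cat// eqxx => /eqP.
rewrite /sqnorm [RHS](eq_esum (b := fun v =>
  ((normc (xi (drop (size w) (w ++ v)))) ^+ 2)%:E)); last first.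
  by move=> v _; rewrite drop_size_cat.
rewrite -[RHS](@esum_image R _ _ setT (cat w)
  (fun v => ((normc (xi (drop (size w) v))) ^+ 2)%:E))//.
rewrite [RHS]esum_mkcond; apply: eq_esum => v _.
case: prefixP => [[u ->]|wv].
  by rewrite ifT// inE; exists u.
rewrite ifF ?normc0 ?expr0n//; apply/negbTE/negP; rewrite inE => -[u _ vE].
by apply: wv; exists u.
Qed.

(* The vector e_w (x) xi, where e_w (x) e_v is identified with e_(wv). *)
Definition fock_tensor w xi : fock R n := Fock (tensor_subproof w xi).

Lemma tensor_basis w v : fock_tensor w (fock_basis v) = fock_basis (w ++ v).
Proof.
apply/val_inj/funext => u /=; case: prefixP => [[u' ->]|wu].
  by rewrite drop_size_cat// eqseq_cat// eqxx.
by case: eqP => // uE; case: wu; exists v.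
Qed.

End fock_vectors.

(* W is the odometer operator W_xi with symbol xi, for n = k.+1 letters: e_1 is
   ord0 and e_n is ord_max.  By odometer_unique below there is at most one such
   W; it need not exist for every xi, since the operator prescribed on the basis
   may be unbounded (for k = 0 it is multiplication by an H^2 function). *)
Record is_odometer (R : realType) (k : nat) (xi : fock R k.+1)
    (W : {linear fock R k.+1 -> fock R k.+1}) : Prop := IsOdometer {
  odometer_bounded : exists M : R, forall x, `|W x| <= M%:C%C * `|x|;
  odometer_vacuum : W (fock_basis [::]) = xi;
  odometer_max : forall m : nat, (0 < m)%N ->
    W (fock_basis (nseq m ord_max)) = fock_tensor (nseq m ord0) xi;
  odometer_succ : forall (j : nat) (i i' : 'I_k.+1) (nu : word k.+1),
    i' = i.+1 :> nat ->
    W (fock_basis (nseq j ord_max ++ i :: nu)) =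
    fock_basis (nseq j ord0 ++ i' :: nu) }.

Definition is_isometry (R : realType) (n : nat)
    (W : fock R n -> fock R n) : Prop :=
  forall x, `|W x| = `|x|.

Section uniqueness.
Context {R : realType}.

Lemma fock_approx (n : nat) (x : fock R n) (e : R) : 0 < e ->
  exists s : seq (word n), `|x - \sum_(w <- s) x w *: fock_basis w| < e%:C%C.
Proof.
move=> e0; have e20 : 0 < e ^+ 2 by rewrite exprn_gt0.
have xfin : (ereal_sup [set (\sum_(w \in A) (normc (x w) ^+ 2)%:E)%E
    | A in fsets [set: word n]]) \is a fin_num.
  by rewrite -[ereal_sup _]/(sqnorm x) -(sqnorm_fin (coordP x)).
have [_ [A [finA _] <-] xA] := ub_ereal_sup_adherent e20 xfin.
exists (finmap.enum_fset (fset_set A)).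
rewrite -[`|_|]/(fock_norm _) /fock_norm ltcR.
rewrite -(@ltr_pXn2r _ 2)// ?nnegrE ?sqrtr_ge0 ?ltW// -lte_fin -sqnorm_sqrt.
set y := \sum_(w <- _) _.
have yE v : y v = if v \in A then x v else 0.
  rewrite -[y v]/((\val y) v) /y raddf_sum fct_sumE /=.
  rewrite (eq_bigr (fun w => if w == v then x w else 0)); last first.
    move=> w _; rewrite -[LHS]/(x w * (v == w)%:R) eq_sym.
    by case: eqP; rewrite (mulr1, mulr0).
  rewrite -big_mkcond -(in_fset_set finA); case: ifPn => vA.
    rewrite -big_filter (perm_big [:: v]) ?big_seq1//.
    by rewrite filter_pred1_uniq ?finmap.fset_uniq.
  rewrite big_seq_cond big1// => w /andP[wA /eqP wv].
  by rewrite -wv wA in vA.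
have -> : sqnorm (x - y) = (\esum_(w in ~` A) (normc (x w) ^+ 2)%:E)%E.
  rewrite [RHS]esum_mkcond; apply: eq_esum => w _.
  rewrite -[(x - y) w]/(x w - y w) yE in_setC.
  by case: (w \in A); rewrite /= ?subr0 ?subrr ?normc0 ?expr0n.
have xE : sqnorm x = (\sum_(w \in A) (normc (x w) ^+ 2)%:E +
    \esum_(w in ~` A) (normc (x w) ^+ 2)%:E)%E.
  rewrite /sqnorm (esumID A)//; last by move=> w _; rewrite lee_fin sqr_ge0.
  by rewrite !setTI esum_fset// => w _; rewrite lee_fin sqr_ge0.
move: xA; rewrite -[ereal_sup _]/(sqnorm x) xE.
move: (sqnorm_fin (coordP x)); rewrite xE.
rewrite fsumEFin//.
case: (\esum_(_ in _) _)%E => [r| |]//=.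
by move=> _; rewrite -?EFinD ?lte_fin; lra.
Qed.

Lemma odometer_unique (k : nat) (xi : fock R k.+1)
    (W1 W2 : {linear fock R k.+1 -> fock R k.+1}) :
  is_odometer xi W1 -> is_odometer xi W2 -> W1 =1 W2.
Proof.
move=> [[M1 bW1] W1v W1m W1s] [[M2 bW2] W2v W2m W2s] x.
have basisE w : W1 (fock_basis w) = W2 (fock_basis w).
  have wE j : W1 (fock_basis (nseq j ord_max ++ w)) =
      W2 (fock_basis (nseq j ord_max ++ w)).
    elim: w j => [|i nu IH] j.
      by rewrite cats0; case: j => [|j]; rewrite ?W1v ?W2v ?W1m ?W2m.
    have [->|im] := eqVneq i ord_max.
      by have := IH (j + 1)%N; rewrite nseqD -catA.
    have ik : (i.+1 < k.+1)%N.
      by rewrite ltn_neqAle ltn_ord andbT eqSS; apply: contra im => /eqP ik;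
         apply/eqP/val_inj.
    by rewrite (W1s _ _ (Ordinal ik)) ?(W2s _ _ (Ordinal ik)).
  exact: (wE 0%N).
apply/eqP; rewrite -subr_eq0 -normr_eq0; apply/eqP.
have small (e : R) : 0 < e -> `|W1 x - W2 x| <= (e)%:C%C.
  move=> e0; pose M := `|M1| + `|M2| + 1.
  have M0 : 0 < M by rewrite ltr_pwDr// addr_ge0.
  have [s xs] := fock_approx x (divr_gt0 e0 M0).
  set y := \sum_(w <- s) _ in xs.
  have yE : W1 y = W2 y.
    rewrite !linear_sum; apply: eq_bigr => w _.
    by rewrite !linearZ /= basisE.
  have -> : W1 x - W2 x = W1 (x - y) - W2 (x - y).
    by rewrite (linearB W1) (linearB W2) /= yE opprB addrA subrK.
  apply: le_trans (ler_normB _ _) _.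
  apply: le_trans (lerD (bW1 _) (bW2 _)) _.
  rewrite -mulrDl -rmorphD /=.
  apply: (@le_trans _ _ (M%:C%C * `|x - y|)).
    by rewrite ler_wpM2r// lecR /M -[leLHS]addr0 !lerD ?ler_norm.
  rewrite -ler_pdivlMl ?ltcR//.
  by apply: (le_trans (ltW xs)); rewrite rmorphM /= fmorphV mulrC.
rewrite -[`|_|]/(fock_norm _) /fock_norm in small *.
congr (_%:C)%C; apply/eqP; rewrite eq_le sqrtr_ge0 andbT.
by apply/ler_addgt0Pr => e e0; rewrite add0r -lecR small.
Qed.

End uniqueness.

(* Main.v *)
(* On basis vectors W_xi is the odometer permutation of words w |-> w + 1, except
   that the powers of e_n are sent to e_1^m (x) xi.  The permutation maps the
   words that are not powers of e_n onto those that are not powers of e_1, so an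
   isometric W_xi forces xi to be orthogonal to the latter, that is, supported
   on the powers of e_1.  What remains is the convolution a |-> c * a on
   sequences, and the conditions on c say that the shifts of c are orthonormal;
   polarization recovers them from an isometric W_xi.

   Conversely, W_xi can be defined by coordinates, since each coefficient of
   c * a is a finite sum.  For finitely supported a, orthonormality gives
   |c * a| = |a|; as the first N coefficients of c * a depend only on those of
   a, this bounds c * a for every square summable a, and the isometry property
   extends by density. *)

Require Import Defs.
From HB Require Import structures.
From mathcomp Require Import all_boot all_order all_algebra.
From mathcomp Require Import complex.
From mathcomp Require Import ring zify.
From mathcomp Require Import all_classical all_reals all_analysis.

Set Implicit Arguments.
Unset Strict Implicit.
Unset Printing Implicit Defensive.

Import Order.TTheory GRing.Theory Num.Theory.
Import numFieldNormedType.Exports.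

Local Open Scope classical_set_scope.
Local Open Scope ring_scope.

(** * Complex limits, sums of squares and polarization *)

Section complex_series.
Context {R : realType}.
Implicit Types (a : nat -> R[i]) (s : R).

Lemma gt0_realC (e : R[i]) : 0 < e -> exists2 d : R, 0 < d & e = d%:C%C.
Proof.
by case: e => a b; rewrite ltcE /= => /andP[/eqP -> a0]; exists a.
Qed.

Lemma cvg_realC (u : nat -> R) s :
  u @ \oo --> s <->
  (fun n => (u n)%:C%C : R[i]^o) @ \oo --> (s%:C%C : R[i]^o).
Proof.
have distE n : `|s%:C%C - (u n)%:C%C| = (`|s - u n|)%:C%C :> R[i].
  by rewrite -rmorphB normc_def /= expr0n addr0 sqrtr_sqr.
split=> /cvgrPdist_lt uP; apply/cvgrPdist_lt => e e0.
  have [d d0 ->] := gt0_realC e0.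
  by near=> n; rewrite distE ltcR; near: n; exact: uP.
have e0' : 0 < e%:C%C :> R[i] by rewrite ltcR.
by near=> n; rewrite -ltcR -distE; near: n; exact: uP.
Unshelve. all: by end_near. Qed.

Lemma sqr_normcE (z : R[i]) : `|z| ^+ 2 = ((Normc.normc z) ^+ 2)%:C%C.
Proof. by rewrite rmorphXn. Qed.

Lemma normc_sqr_ge0 (z : R[i]) : (0 <= (Normc.normc z ^+ 2)%:E)%E.
Proof. by rewrite lee_fin sqr_ge0. Qed.

(** Links limits in [R[i]], where the conditions on coefficients live, to the extended-real sums
    behind [sqnorm]. The latter always converge, so only their value matters. *)
Lemma cvg_series_sqr_norm a s :
  series (fun p => `|a p| ^+ 2 : R[i]^o) @ \oo --> (s%:C%C : R[i]^o) <->
  (\esum_(p in [set: nat]) (Normc.normc (a p) ^+ 2)%:E = s%:E)%E.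
Proof.
pose v n := \sum_(0 <= p < n) Normc.normc (a p) ^+ 2.
have -> : series (fun p => `|a p| ^+ 2 : R[i]^o) =
    (fun n => (v n)%:C%C : R[i]^o).
  apply/funext => n; rewrite /series /v /= rmorph_sum /=.
  by apply: eq_bigr => p _; rewrite sqr_normcE.
rewrite -cvg_realC -nneseries_esumT; last by move=> p; exact: normc_sqr_ge0.
have vE : (fun n => \sum_(0 <= p < n) (Normc.normc (a p) ^+ 2)%:E)%E =
    EFin \o v.
  by apply/funext => n; rewrite /v /= sumEFin.
have cv : cvgn (fun n => \sum_(0 <= p < n) (Normc.normc (a p) ^+ 2)%:E)%E.
  by apply: is_cvg_nneseries => *; exact: normc_sqr_ge0.
split=> [vs|].
  by apply/cvg_lim => //; rewrite vE; apply/fine_cvgP; split=> //; exact: nearW.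
move=> vs.
have : (fun n => \sum_(0 <= p < n) (Normc.normc (a p) ^+ 2)%:E)%E @ \oo -->
    s%:E by rewrite -vs; exact: cv.
by rewrite vE => /fine_cvgP[].
Qed.

(** The first bracket is twice the real part of [x * y^*%C], the second twice its imaginary part. *)
Lemma mul_conj_polarization (x y : R[i]) :
  2 * (x * y^*%C) =
  (`|x + y| ^+ 2 - `|x| ^+ 2 - `|y| ^+ 2) +
  'i%C * (`|x + 'i%C * y| ^+ 2 - `|x| ^+ 2 - `|y| ^+ 2).
Proof.
rewrite !sqr_normc !rmorphD !rmorphM /=.
have -> : (0 +i* (-1))%C = - 'i%C :> R[i]
  by apply/eqP; rewrite eq_complex /= oppr0 !eqxx.
have i2 : 'i%C ^+ 2 + 1 = 0 :> R[i] by rewrite sqr_i addNr.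
apply/eqP; rewrite -subr_eq0; apply/eqP; set j := 'i%C in i2 *.
(* The difference of the two sides is a multiple of [j ^+ 2 + 1], by an identity in which [j] and
   both conjugates may be arbitrary. *)
transitivity ((j ^+ 2 + 1) * (x * y^*%C - y * x^*%C + j * (y * y^*%C))).
  by move: j i2 x^*%C y^*%C => j _ x' y'; ring.
by rewrite i2 mul0r.
Qed.

End complex_series.

(** * Norms in Fock space, coordinate by coordinate *)

Section fock_norms.
Context {R : realType} {n : nat}.
Implicit Types (x y : fock R n) (u w : word n).

Lemma sqr_fock_norm x : `|x| ^+ 2 = (fine (sqnorm x))%:C%C.
Proof.
rewrite -[`|x|]/(fock_norm x) /fock_norm -rmorphXn /= sqr_sqrtr//.
by rewrite fine_ge0// sqnorm_ge0.
Qed.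

Lemma fockDE x y w : (x + y) w = x w + y w.
Proof. by []. Qed.

Lemma fockZE (l : R[i]) x w : (l *: x) w = l * x w.
Proof. by []. Qed.

Lemma fockBE x y w : (x - y) w = x w - y w.
Proof. by []. Qed.

Lemma fock_basisE w u : fock_basis w u = (u == w)%:R :> R[i].
Proof. by []. Qed.

Lemma fock_sumE I (r : seq I) (F : I -> fock R n) w :
  (\sum_(i <- r) F i) w = \sum_(i <- r) F i w.
Proof. by rewrite -[LHS]/((val _) w) raddf_sum fct_sumE. Qed.

Lemma fockP x y : (forall w, x w = y w) -> x = y.
Proof. by move=> xy; apply/val_inj/funext. Qed.

Lemma norm_coord_le x w : `|x w| <= `|x|.
Proof.
rewrite -(@ler_pXn2r _ 2)// ?nnegrE ?normr_ge0// sqr_fock_norm sqr_normcE.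
by rewrite lecR -lee_fin sqnorm_fin ?coordP// coord_le_sqnorm.
Qed.

Lemma sqnorm_coord (f : word n -> R[i]) u :
  sqnorm f = ((Normc.normc (f u) ^+ 2)%:E +
    \esum_(w in ~` [set u]) (Normc.normc (f w) ^+ 2)%:E)%E.
Proof.
rewrite /sqnorm (esumID [set u]); last by move=> w _; exact: normc_sqr_ge0.
by rewrite !setTI esum_set1// normc_sqr_ge0.
Qed.

(** Only the coordinate at [u] changes. This stands in for an inner product: it yields Pythagoras
    for basis vectors, the tails of expansions and orthogonality to [fock_basis u]. *)
Lemma sqr_norm_add_basis x u (l : R[i]) :
  `|x + l *: fock_basis u| ^+ 2 + `|x u| ^+ 2 = `|x| ^+ 2 + `|x u + l| ^+ 2.
Proof.
set y := x + _.
rewrite !sqr_fock_norm !sqr_normcE -!rmorphD; congr (_%:C%C).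
have := sqnorm_fin (coordP x); have := sqnorm_fin (coordP y).
rewrite !(sqnorm_coord _ u).
have -> : \esum_(w in ~` [set u]) (Normc.normc (y w) ^+ 2)%:E =
    \esum_(w in ~` [set u]) (Normc.normc (x w) ^+ 2)%:E.
  apply: eq_esum => w /eqP wu.
  by rewrite fockDE fockZE fock_basisE (negbTE wu) mulr0 addr0.
have -> : x u + l = y u by rewrite fockDE fockZE fock_basisE eqxx mulr1.
case: (\esum_(_ in _) _) => [r| |] //= _ _.
by rewrite -addrA addrC [_ + r]addrC.
Qed.

Lemma sqr_norm_basis u : `|fock_basis u : fock R n| ^+ 2 = 1.
Proof.
have := sqr_norm_add_basis 0 u 1.
rewrite add0r scale1r normr0 -[(0 : fock R n) u]/(0 : R[i]) normr0 add0r.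
by rewrite normr1 expr0n expr1n addr0 add0r.
Qed.

Lemma sqr_norm_basisD u w (l : R[i]) : u != w ->
  `|fock_basis u + l *: fock_basis w : fock R n| ^+ 2 = 1 + `|l| ^+ 2.
Proof.
move=> uw; have := sqr_norm_add_basis (fock_basis u) w l.
rewrite fock_basisE eq_sym (negbTE uw) normr0 expr0n addr0 add0r.
by rewrite sqr_norm_basis.
Qed.

(** The odometer treats the powers of one letter apart: [ord_max] in its domain, [ord0] in its
    range. *)
Lemma sqnorm_split (i : 'I_n) (f : word n -> R[i]) :
  sqnorm f = (\esum_(p in [set: nat]) (Normc.normc (f (nseq p i)) ^+ 2)%:E +
    \esum_(u in [set u : word n | ~~ all (pred1 i) u])
      (Normc.normc (f u) ^+ 2)%:E)%E.
Proof.
rewrite /sqnorm (esumID [set u : word n | all (pred1 i) u]); last first.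
  by move=> w _; exact: normc_sqr_ge0.
rewrite !setTI; congr (_ + _)%E; last first.
  by congr esum; apply/seteqP; split=> u /= /negP.
rewrite -[RHS](@esum_image _ _ _ _ (fun p => nseq p i)
  (fun u => (Normc.normc (f u) ^+ 2)%:E)); last first.
  by move=> p q _ _ /(congr1 size); rewrite !size_nseq.
congr esum; apply/seteqP; split=> u /=.
  by move=> /all_pred1P ->; exists (size u).
by move=> [p _ <-]; rewrite all_nseq /= eqxx orbT.
Qed.

End fock_norms.

(** * Delayed sequences, their orthonormality, and convolution *)

Section autocorrelation.
Context {R : realType}.
Implicit Types (c : nat -> R[i]).

(** The [m]-th power of the unilateral shift; along the powers of $e_1$ it is left tensoring by
    $e_1^{\otimes m}$. *)
Definition delay (m : nat) c (p : nat) : R[i] :=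
  if (m <= p)%N then c (p - m)%N else 0.

Lemma delay0 c : delay 0 c = c.
Proof. by apply/funext => p; rewrite /delay leq0n subn0. Qed.

Lemma cvg_series_delay (m : nat) c (s : R[i]) :
  series (delay m c : nat -> R[i]^o) @ \oo --> (s : R[i]^o) <->
  series (c : nat -> R[i]^o) @ \oo --> (s : R[i]^o).
Proof.
rewrite -(cvg_shiftn m).
have -> : [sequence series (delay m c : nat -> R[i]^o) (n + m)%N]_n =
    series (c : nat -> R[i]^o) => //.
apply/funext => n; rewrite /series /= (@big_cat_nat _ _ _ m) ?leq_addl//=.
rewrite big_nat big1 ?add0r => [|p /andP[_ pm]]; last first.
  by rewrite /delay leqNgt pm.
rewrite -{1}[m]add0n big_addn addnK; apply: eq_bigr => p _.
by rewrite /delay leq_addl addnK.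
Qed.

Lemma cvg_series_conj c :
  series (c : nat -> R[i]^o) @ \oo --> (0 : R[i]^o) ->
  series (fun p => (c p)^*%C : R[i]^o) @ \oo --> (0 : R[i]^o).
Proof.
move=> /cvgr0Pnorm_lt c0; apply/cvgr0Pnorm_lt => e e0.
near=> n.
have -> : series (fun p => (c p)^*%C : R[i]^o) n =
    (series (c : nat -> R[i]^o) n)^*%C.
  by rewrite /series /= rmorph_sum.
rewrite [X in X < _](_ : _ = `|series (c : nat -> R[i]^o) n|).
  by near: n; exact: c0.
by case: (series _ _) => a b; rewrite !normc_def /= sqrrN.
Unshelve. all: by end_near. Qed.

(** Reindexing by [r] turns one series into the conjugate of the other, and the limit 0 is its own
    conjugate. *)
Lemma cvg_series_delay_conj c (r : nat) :
  series (fun p => delay r c p * (c p)^*%C : R[i]^o) @ \oo --> (0 : R[i]^o) <->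
  series (fun p => c (p + r)%N * (c p)^*%C : R[i]^o) @ \oo --> (0 : R[i]^o).
Proof.
have -> : (fun p => delay r c p * (c p)^*%C) =
    delay r (fun p => c p * (c (p + r)%N)^*%C).
  by apply/funext => p; rewrite /delay; case: leqP => rp; rewrite ?mul0r ?subnK.
rewrite cvg_series_delay; split=> /cvg_series_conj;
  under eq_fun do rewrite rmorphM /= conjcK mulrC; exact.
Qed.

(** Reindexing removes the smaller delay and leaves an autocorrelation at lag $|m-l|$, or the square
    norm of [c] if the delays agree; the case [m < l] needs a conjugation first. *)
Lemma cvg_series_delay_delay c (m l : nat) :
  series (fun p => `|c p| ^+ 2 : R[i]^o) @ \oo --> (1 : R[i]^o) ->
  (forall r, (1 <= r)%N ->
    series (fun p => c (p + r)%N * (c p)^*%C : R[i]^o) @ \oo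
      --> (0 : R[i]^o)) ->
  series (fun p => delay m c p * (delay l c p)^*%C : R[i]^o) @ \oo
    --> ((m == l)%:R : R[i]^o).
Proof.
move=> c1 c0.
have delayE a b : (a <= b)%N ->
    (fun p => delay b c p * (delay a c p)^*%C) =
    delay a (fun p => delay (b - a) c p * (c p)^*%C).
  move=> ab; apply/funext => p; rewrite /delay; case: (leqP a p) => ap.
    by rewrite leq_sub2rE// subnBA// subnK.
  by rewrite leqNgt (leq_trans ap ab) mul0r.
case: (ltngtP m l) => [ml|lm|->].
- under eq_fun do rewrite -[delay m c _]conjcK -rmorphM mulrC /=.
  apply: cvg_series_conj; rewrite (delayE _ _ (ltnW ml)).
  by apply/cvg_series_delay/cvg_series_delay_conj/c0; rewrite subn_gt0.
- rewrite (delayE _ _ (ltnW lm)).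
  by apply/cvg_series_delay/cvg_series_delay_conj/c0; rewrite subn_gt0.
- rewrite (delayE _ _ (leqnn l)); apply/cvg_series_delay.
  by rewrite subnn delay0; under eq_fun do rewrite -sqr_normc.
Qed.

Definition convolution c (a : nat -> R[i]) (p : nat) : R[i] :=
  \sum_(m < p.+1) a m * c (p - m)%N.

(** Trades the range [p.+1], which varies with the coefficient, for a fixed one, so that the
    convolution is a finite combination of delays of [c]. *)
Lemma convolution_delay c a (M p : nat) :
  (forall m, (M <= m)%N -> a m = 0) ->
  convolution c a p = \sum_(m < M) a m * delay m c p.
Proof.
move=> a0.
have E N : (p < N)%N -> (M <= N)%N ->
    convolution c a p = \sum_(m < N) a m * delay m c p.
  move=> pN MN; rewrite /convolution.
  rewrite (big_ord_widen _ (fun m => a m * c (p - m)%N) pN) big_mkcond.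
  by apply: eq_bigr => m _; rewrite /delay ltnS; case: ifP; rewrite ?mulr0.
(* Both sums are extended to a common range: the added terms vanish through [delay] when [p < m] and
   through [a0] when [M <= m]. *)
rewrite (E (maxn p.+1 M)) ?leq_maxl ?leq_maxr//.
rewrite (big_ord_widen _ (fun m => a m * delay m c p) (leq_maxr p.+1 M)).
rewrite [RHS]big_mkcond; apply: eq_bigr => m _.
by case: ltnP => // Mm; rewrite a0 ?mul0r.
Qed.

Lemma cvg_series_sum (I : Type) (r : seq I) (F : I -> nat -> R[i])
    (s : I -> R[i]) :
  (forall i, series (F i : nat -> R[i]^o) @ \oo --> (s i : R[i]^o)) ->
  series (fun p => \sum_(i <- r) F i p : R[i]^o) @ \oo
    --> (\sum_(i <- r) s i : R[i]^o).
Proof.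
move=> Fs.
have -> : series (fun p => \sum_(i <- r) F i p : R[i]^o) =
    (fun n => \sum_(i <- r) series (F i : nat -> R[i]^o) n).
  by apply/funext => n; rewrite /series /= exchange_big.
elim: r => [|i r IH].
  by under eq_fun do rewrite big_nil; rewrite big_nil; exact: cvg_cst.
under eq_fun do rewrite big_cons; rewrite big_cons.
exact: cvgD (Fs i) IH.
Qed.

Lemma cvg_seriesZ (F : nat -> R[i]) (l s : R[i]) :
  series (F : nat -> R[i]^o) @ \oo --> (s : R[i]^o) ->
  series (fun p => l * F p : R[i]^o) @ \oo --> (l * s : R[i]^o).
Proof.
move=> Fs.
have -> : series (fun p => l * F p : R[i]^o) =
    (fun n => l *: series (F : nat -> R[i]^o) n).
  by apply/funext => n; rewrite /series /= -mulr_sumr.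
exact: (@cvgZl_tmp _ R[i]^o).
Qed.

Lemma cvg_seriesD (F G : nat -> R[i]) (s t : R[i]) :
  series (F : nat -> R[i]^o) @ \oo --> (s : R[i]^o) ->
  series (G : nat -> R[i]^o) @ \oo --> (t : R[i]^o) ->
  series (fun p => F p + G p : R[i]^o) @ \oo --> (s + t : R[i]^o).
Proof.
move=> Fs Gt; rewrite -[X in series X]/((F : nat -> R[i]^o) + G) seriesD.
exact: cvgD.
Qed.

Lemma cvg_seriesB (F G : nat -> R[i]) (s t : R[i]) :
  series (F : nat -> R[i]^o) @ \oo --> (s : R[i]^o) ->
  series (G : nat -> R[i]^o) @ \oo --> (t : R[i]^o) ->
  series (fun p => F p - G p : R[i]^o) @ \oo --> (s - t : R[i]^o).
Proof.
move=> Fs /(cvg_seriesZ (l := -1)); rewrite mulN1r => Gt.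
by under eq_fun do rewrite -mulN1r; exact: cvg_seriesD.
Qed.

Section isometric_convolution.
Variable c : nat -> R[i].
Hypothesis c1 : series (fun p => `|c p| ^+ 2 : R[i]^o) @ \oo --> (1 : R[i]^o).
Hypothesis c0 : forall r, (1 <= r)%N ->
  series (fun p => c (p + r)%N * (c p)^*%C : R[i]^o) @ \oo --> (0 : R[i]^o).

(** The square norm expands into a finite double sum, so limits pass termwise, and orthonormality of
    the delays leaves the diagonal. *)
Lemma esum_convolution_finite a (M : nat) :
  (forall m, (M <= m)%N -> a m = 0) ->
  \esum_(p in [set: nat]) (Normc.normc (convolution c a p) ^+ 2)%:E =
  (\sum_(m < M) Normc.normc (a m) ^+ 2)%:E.
Proof.
move=> a0; apply/cvg_series_sqr_norm.
have -> : ((\sum_(m < M) Normc.normc (a m) ^+ 2)%:C)%C =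
    \sum_(m < M) a m * \sum_(l < M) (a l)^*%C * (m == l :> nat)%:R :> R[i].
  rewrite rmorph_sum /=; apply: eq_bigr => m _.
  rewrite -sqr_normcE sqr_normc (bigD1 m)//= eqxx mulr1 big1 ?addr0// => l.
  by rewrite eq_sym -val_eqE /= => /negbTE ->; rewrite mulr0.
have -> : (fun p => `|convolution c a p| ^+ 2) = (fun p => \sum_(m < M) a m *
    \sum_(l < M) (a l)^*%C * (delay m c p * (delay l c p)^*%C)).
  apply/funext => p; rewrite sqr_normc (convolution_delay _ _ a0).
  rewrite rmorph_sum mulr_suml; apply: eq_bigr => m _.
  rewrite mulr_sumr mulr_sumr; apply: eq_bigr => l _.
  by rewrite rmorphM /=; ring.
apply: cvg_series_sum => m; apply: cvg_seriesZ.
apply: cvg_series_sum => l; apply: cvg_seriesZ.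
exact: cvg_series_delay_delay.
Qed.

(* The first N coefficients of the convolution depend only on the first N
   coefficients of a, so the finitely supported case bounds all partial sums. *)
Lemma esum_convolution_le a :
  (\esum_(p in [set: nat]) (Normc.normc (convolution c a p) ^+ 2)%:E <=
   \esum_(p in [set: nat]) (Normc.normc (a p) ^+ 2)%:E)%E.
Proof.
rewrite -!nneseries_esumT; try by move=> p; exact: normc_sqr_ge0.
apply: lime_le; first by apply: is_cvg_nneseries => *; exact: normc_sqr_ge0.
apply: nearW => N; pose b m := if (m < N)%N then a m else 0.
have b0 m : (N <= m)%N -> b m = 0 by rewrite /b ltnNge => ->.
apply: (@le_trans _ _ (\sum_(0 <= p < N) (Normc.normc (a p) ^+ 2)%:E)%E).
  apply: (@le_trans _ _
    (\sum_(0 <= p < N) (Normc.normc (convolution c b p) ^+ 2)%:E)%E).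
    rewrite le_eqVlt; apply/orP; left; apply/eqP.
    apply: eq_big_nat => p /andP[_ pN]; congr (Normc.normc _ ^+ 2)%:E.
    apply: eq_bigr => m _; rewrite /b ifT//.
    by rewrite (leq_ltn_trans _ pN)// -ltnS.
  apply: (@le_trans _ _
    (\esum_(p in [set: nat]) (Normc.normc (convolution c b p) ^+ 2)%:E)).
    rewrite -nneseries_esumT; last by move=> p; exact: normc_sqr_ge0.
    by apply: nneseries_lim_ge => *; exact: normc_sqr_ge0.
  rewrite (esum_convolution_finite b0) sumEFin big_mkord lee_fin.
  by apply: ler_sum => m _; rewrite /b ltn_ord.
by apply: nneseries_lim_ge => *; exact: normc_sqr_ge0.
Qed.

End isometric_convolution.
End autocorrelation.

(** * Vectors supported on the powers of one letter *)

Section zero_words.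
Context {R : realType} {k : nat}.
Implicit Types (x : fock R k.+1) (u w : word k.+1) (i : 'I_k.+1).

Definition supported_on_powers i x := forall u, ~~ all (pred1 i) u -> x u = 0.

Lemma supported_sqnorm i x : supported_on_powers i x ->
  sqnorm x =
  (\esum_(p in [set: nat]) (Normc.normc (x (nseq p i)) ^+ 2)%:E)%E.
Proof.
move=> x0; rewrite (sqnorm_split i) [X in (_ + X)%E]esum1 ?adde0// => u /= u0.
by rewrite (x0 _ u0) Normc.normc0 expr0n.
Qed.

Lemma supported_cvg_series i x : supported_on_powers i x ->
  series (fun p => `|x (nseq p i)| ^+ 2 : R[i]^o) @ \oo
    --> (`|x| ^+ 2 : R[i]^o).
Proof.
move=> x0; rewrite sqr_fock_norm; apply/cvg_series_sqr_norm.
by rewrite -(supported_sqnorm x0) sqnorm_fin// coordP.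
Qed.

Lemma nseq_inj i : injective (fun p => nseq p i).
Proof. by move=> p q /(congr1 size); rewrite !size_nseq. Qed.

Lemma series_powers_coord i (c : nat -> R[i]) N p :
  series (fun q => c q *: (fock_basis (nseq q i) : fock R k.+1)) N (nseq p i) =
  if (p < N)%N then c p else 0.
Proof.
rewrite /series /= fock_sumE big_mkord.
rewrite (eq_bigr (fun q : 'I_N => if (q == p :> nat) then c p else 0)).
  rewrite -big_mkcond; case: ltnP => pN.
    by rewrite (big_pred1 (Ordinal pN)).
  by rewrite big1// => q /eqP qp; rewrite -qp leqNgt ltn_ord in pN.
move=> q _; rewrite fockZE fock_basisE (inj_eq (nseq_inj (i := i))) eq_sym.
by case: eqP => [->|_]; rewrite ?mulr1 ?mulr0.
Qed.

Lemma series_powers_coord0 i (c : nat -> R[i]) N u : ~~ all (pred1 i) u ->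
  series (fun q => c q *: (fock_basis (nseq q i) : fock R k.+1)) N u = 0.
Proof.
move=> u0; rewrite /series /= fock_sumE big1// => q _.
rewrite fockZE fock_basisE; case: eqP => [uq|_]; last by rewrite mulr0.
by rewrite uq all_nseq /= eqxx orbT in u0.
Qed.

(** By induction on [N]: the partial sum still vanishes at [nseq N i], so the next term clears
    exactly that coordinate of the difference. *)
Lemma sqr_norm_tail i x N :
  `|x - series (fun p => x (nseq p i) *: fock_basis (nseq p i)) N| ^+ 2 =
  `|x| ^+ 2 - series (fun p => `|x (nseq p i)| ^+ 2 : R[i]^o) N.
Proof.
elim: N => [|N IH]; first by rewrite /series /= !big_geq// !subr0.
set S := series _ in IH *; set s := series _ in IH *.
have SE : S N.+1 = S N + x (nseq N i) *: fock_basis (nseq N i).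
  by rewrite /S seriesSr.
have sE : s N.+1 = s N + `|x (nseq N i)| ^+ 2 by rewrite /s seriesSr.
have := sqr_norm_add_basis (x - S N) (nseq N i) (- x (nseq N i)).
rewrite fockBE series_powers_coord ltnn subr0 subrr normr0 expr0n addr0 IH.
by rewrite scaleNr -addrA -opprD -SE sE opprD addrA => <-; rewrite addrK.
Qed.

Lemma supported_cvg i x : supported_on_powers i x ->
  series (fun p => x (nseq p i) *: fock_basis (nseq p i)) @ \oo --> x.
Proof.
move=> /supported_cvg_series/cvgrPdist_lt xs; apply/cvgrPdist_lt => e e0.
have e20 : 0 < e ^+ 2 by rewrite exprn_gt0.
near=> N; rewrite -(@ltr_pXn2r _ 2)// ?nnegrE ?normr_ge0 ?ltW//.
rewrite -[ltLHS]ger0_norm ?exprn_ge0// sqr_norm_tail; near: N.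
exact: xs.
Unshelve. all: by end_near. Qed.

Lemma cvg_fock_coord (u : word k.+1) (F : nat -> fock R k.+1) x :
  F @ \oo --> x -> (fun N => F N u : R[i]^o) @ \oo --> (x u : R[i]^o).
Proof.
move=> /cvgrPdist_lt Fx; apply/cvgrPdist_lt => e e0.
near=> N; apply: (@le_lt_trans _ _ `|x - F N|).
  by rewrite -fockBE norm_coord_le.
by near: N; exact: Fx.
Unshelve. all: by end_near. Qed.

(** Taking a coordinate is contractive, and each coordinate of the partial sums is eventually
    constant. *)
Lemma powers_cvg_coord i (c : nat -> R[i]) x :
  series (fun q => c q *: fock_basis (nseq q i)) @ \oo --> x ->
  (forall p, x (nseq p i) = c p) /\ supported_on_powers i x.
Proof.
move=> cx; split=> [p|u u0].
  have := cvg_fock_coord (u := nseq p i) cx.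
  under eq_fun do rewrite series_powers_coord.
  (* After this shift every partial sum contains the term of index [p]. *)
  rewrite -(cvg_shiftn p.+1) /=.
  under eq_fun do rewrite leq_addl.
  by move=> /(cvg_unique _ (cvg_cst _)) ->.
have := cvg_fock_coord (u := u) cx.
under eq_fun do rewrite series_powers_coord0//.
by move=> /(cvg_unique _ (cvg_cst _)) ->.
Qed.

(** Here [i'] is the first letter other than [ord0], hence has a predecessor. This exhibits [u] as a
    word reached by [odometer_succ]. *)
Lemma nonzero_word_split u : ~~ all (pred1 ord0) u ->
  exists j (i i' : 'I_k.+1) nu,
    i' = i.+1 :> nat /\ u = nseq j ord0 ++ i' :: nu.
Proof.
elim: u => // i' nu IH; rewrite /= negb_and.
have [->|i0 _] := eqVneq i' ord0.
  by move=> /IH[j [i [i'' [nu' [ii' ->]]]]]; exists j.+1, i, i'', nu'.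
have i'_gt0 : (0 < i')%N by rewrite lt0n.
have ik : (i'.-1 < k.+1)%N by rewrite (leq_ltn_trans (leq_pred _)) ?ltn_ord.
by exists 0, (Ordinal ik), i', nu; rewrite /= prednK.
Qed.

Lemma tensor_powers_coord (xi : fock R k.+1) m p :
  fock_tensor (nseq m ord0) xi (nseq p ord0) =
  delay m (fun q => xi (nseq q ord0)) p.
Proof.
rewrite /= /delay size_nseq; case: leqP => mp.
  rewrite -{1 2}(subnKC mp) nseqD prefix_prefix drop_cat size_nseq ltnn.
  by rewrite subnn drop0.
by case: prefixP => // -[v /(congr1 size)]; rewrite size_cat !size_nseq; lia.
Qed.

Lemma tensor_supported (xi : fock R k.+1) m : supported_on_powers ord0 xi ->
  supported_on_powers ord0 (fock_tensor (nseq m ord0) xi).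
Proof.
move=> xi0 u u0 /=; case: prefixP => // -[v uE]; apply: xi0.
by move: u0; rewrite uE drop_size_cat// all_cat all_nseq /= eqxx orbT.
Qed.

End zero_words.

(** * Necessity: what an isometric odometer forces on its symbol *)

Section isometric_odometer.
Context {R : realType} {k : nat}.
Variables (xi : fock R k.+1) (W : {linear fock R k.+1 -> fock R k.+1}).
Hypotheses (W_odometer : is_odometer xi W) (W_isometry : is_isometry W).

Lemma isometric_symbol_norm : `|xi| ^+ 2 = 1.
Proof.
by rewrite -(odometer_vacuum W_odometer) W_isometry sqr_norm_basis.
Qed.

(* If [u] has a letter other than [e_1], [e_u] is the image of a basis vector
   orthogonal to the vacuum, so it must be orthogonal to [xi]. *)
Lemma isometric_symbol_supported : supported_on_powers ord0 xi.
Proof.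
move=> u u0; have [j [i [i' [nu [ii' uE]]]]] := nonzero_word_split u0.
(* Adding this multiple of the basis vector doubles the coordinate at [u]; the two computations of
   the norm then give $1+2|l|^2=1+4|l|^2$. *)
pose l := xi u.
have : `|xi + l *: fock_basis u| ^+ 2 = 1 + `|l| ^+ 2.
  rewrite uE -(odometer_succ W_odometer _ _ ii') -(odometer_vacuum W_odometer).
  rewrite -linearZ -linearD W_isometry sqr_norm_basisD//.
  by rewrite eq_sym; case: (j).
have := sqr_norm_add_basis xi u l.
rewrite isometric_symbol_norm => + lE; rewrite lE -/l -mulr2n normrMn.
rewrite exprMn_n -addrA => /addrI.
rewrite -mulr2n -[(2 ^ 2)%N]/(2 + 2)%N mulrnDr -[LHS]addr0 => /addrI/esym/eqP.
by rewrite mulrn_eq0 sqrf_eq0 normr_eq0 => /eqP.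
Qed.

(** The vectors $e_1^{\otimes r}\otimes\xi$ and $\xi$ are the images of the orthonormal vectors
    $e_n^{\otimes r}$ and $\Omega$, which fixes the norms of their combinations; polarization then
    gives their inner product. *)
Lemma isometric_symbol_autocorrelation r : (1 <= r)%N ->
  series (fun p => xi (nseq (p + r) ord0) * (xi (nseq p ord0))^*%C : R[i]^o)
    @ \oo --> (0 : R[i]^o).
Proof.
move=> r0; pose c p := xi (nseq p ord0).
apply/(cvg_series_delay_conj c r).
pose y := fock_tensor (nseq r ord0) xi.
have normE (l : R[i]) : `|y + l *: xi| ^+ 2 = 1 + `|l| ^+ 2.
  rewrite /y -(odometer_max W_odometer r0) -(odometer_vacuum W_odometer).
  rewrite -linearZ -linearD W_isometry sqr_norm_basisD//.
  by case: (r) r0.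
have cvgE (l : R[i]) : series (fun p => `|delay r c p + l * c p| ^+ 2 : R[i]^o)
    @ \oo --> (1 + `|l| ^+ 2 : R[i]^o).
  rewrite -normE.
  under eq_fun do rewrite -tensor_powers_coord -fockZE -fockDE.
  apply: supported_cvg_series => u u0.
  rewrite fockDE fockZE isometric_symbol_supported//.
  by rewrite (tensor_supported _ isometric_symbol_supported)// mulr0 addr0.
(* The value [l = 0] gives the square norm of the delayed sequence. *)
have := cvgE 0; rewrite normr0 expr0n addr0.
under eq_fun do rewrite mul0r addr0.
move=> y1.
have xi1 := supported_cvg_series isometric_symbol_supported.
rewrite isometric_symbol_norm in xi1.
have two0 : (2 : R[i]) != 0 by rewrite pnatr_eq0.
have cross (l : R[i]) : `|l| = 1 ->
    series (fun p => `|delay r c p + l * c p| ^+ 2 - `|delay r c p| ^+ 2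
      - `|c p| ^+ 2 : R[i]^o) @ \oo --> (0 : R[i]^o).
  move=> l1; have -> : 0 = 1 + `|l| ^+ 2 - 1 - 1 :> R[i].
    by rewrite l1 expr1n addrK subrr.
  exact: cvg_seriesB (cvg_seriesB (cvgE l) y1) xi1.
(* The factor 2 prepares [mul_conj_polarization], whose brackets are [cross] at [l = 1] and at
   [l = 'i%C]. *)
suff : series (fun p => 2^-1 * (2 * (delay r c p * (c p)^*%C)) : R[i]^o) @ \oo
    --> (2^-1 * (0 + 'i%C * 0) : R[i]^o).
  rewrite mulr0 addr0 mulr0.
  by under eq_fun do rewrite mulKf//.
apply: cvg_seriesZ; under eq_fun do rewrite mul_conj_polarization.
apply: cvg_seriesD; last by apply: cvg_seriesZ; apply: cross;
  rewrite normc_def /= expr0n expr1n add0r sqrtr1.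
under eq_fun do rewrite -[c _ in X in `|_ + X|]mul1r.
by apply: cross; rewrite normr1.
Qed.

End isometric_odometer.

(** * The odometer permutation of words *)

Section odometer_permutation.
Context {k : nat}.
Implicit Types u w : word k.+1.

(** The least significant letter comes first. A carry past the last letter is dropped, which makes
    the map a bijection of all words; [odometer_coord] replaces its action on the powers of
    [ord_max]. *)
Fixpoint odo_succ w : word k.+1 :=
  if w is i :: v then
    if i == ord_max then ord0 :: odo_succ v else inord i.+1 :: v
  else [::].

Fixpoint odo_pred u : word k.+1 :=
  if u is i :: v then
    if i == ord0 then ord_max :: odo_pred v else inord i.-1 :: v
  else [::].

Lemma ord_succ_lt (i : 'I_k.+1) : i != ord_max -> (i.+1 < k.+1)%N.
Proof. by move=> im; rewrite ltn_neqAle ltn_ord andbT. Qed.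

Lemma odo_succK : cancel odo_succ odo_pred.
Proof.
elim=> //= i v IH; have [->|im] := eqVneq i ord_max; first by rewrite /= IH.
have ik := ord_succ_lt im.
rewrite /= -val_eqE /= inordK//=; congr cons; apply/val_inj.
by rewrite /= inordK.
Qed.

Lemma odo_predK : cancel odo_pred odo_succ.
Proof.
elim=> //= i v IH; have [->|i0] := eqVneq i ord0; first by rewrite /= eqxx IH.
have i_gt0 : (0 < i)%N by rewrite lt0n.
have ik := ltn_ord i.
rewrite /= -val_eqE /= inordK ?(leq_ltn_trans (leq_pred _))//.
rewrite ifF; last by apply/negbTE; lia.
by rewrite prednK// inord_val.
Qed.

(** A letter other than [ord_max] becomes a nonzero letter, so only a complete overflow produces a
    power of [ord0]. *)
Lemma odo_succ_zero w : all (pred1 ord0) (odo_succ w) = all (pred1 ord_max) w.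
Proof.
elim: w => //= i v IH; have [_|im] := eqVneq i ord_max; first by rewrite /= IH.
have ik := ord_succ_lt im.
by rewrite /= -val_eqE /= inordK.
Qed.

Lemma odo_succ_cat j (i i' : 'I_k.+1) (v : word k.+1) : i' = i.+1 :> nat ->
  odo_succ (nseq j ord_max ++ i :: v) = nseq j ord0 ++ i' :: v.
Proof.
move=> ii'; elim: j => [|j IH] /=; last by rewrite eqxx IH.
rewrite -val_eqE /= ltn_eqF; last by rewrite -ltnS -ii' ltn_ord.
by congr cons; apply/val_inj; rewrite /= inordK -ii'.
Qed.

End odometer_permutation.

(** * Sufficiency: the operator built from its coordinates *)

Section odometer_operator.
Context {R : realType} {k : nat}.
Variable xi : fock R k.+1.
Local Notation c := (fun p => xi (nseq p ord0)).
Hypothesis xi_supported : supported_on_powers ord0 xi.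
Hypothesis c1 : series (fun p => `|c p| ^+ 2 : R[i]^o) @ \oo --> (1 : R[i]^o).
Hypothesis c0 : forall r, (1 <= r)%N ->
  series (fun p => c (p + r)%N * (c p)^*%C : R[i]^o) @ \oo --> (0 : R[i]^o).

(** At $e_1^{\otimes p}$ the contributions come from $e_1^{\otimes m}\otimes\xi$ with $m\le p$; any
    other word has a single source. *)
Definition odometer_coord (x : word k.+1 -> R[i]) (u : word k.+1) : R[i] :=
  if all (pred1 ord0) u then
    convolution c (fun m => x (nseq m ord_max)) (size u)
  else x (odo_pred u).

(** The permutation matches the remaining words on both sides, so norm questions reduce to the
    convolution. The values are extended reals because square summability of the image is derived
    from this. *)
Lemma sqnorm_odometer_coord x : sqnorm (odometer_coord x) =
  (\esum_(p in [set: nat])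
     (Normc.normc (convolution c (fun m => x (nseq m ord_max)) p) ^+ 2)%:E +
   \esum_(u in [set u : word k.+1 | ~~ all (pred1 ord_max) u])
     (Normc.normc (x u) ^+ 2)%:E)%E.
Proof.
rewrite (sqnorm_split ord0); congr (_ + _)%E.
  apply: eq_esum => p _.
  by rewrite /odometer_coord all_nseq /= eqxx orbT size_nseq.
rewrite (reindex_esum [set u : word k.+1 | ~~ all (pred1 ord_max) u] _
  odo_succ).
  apply: eq_esum => w /negbTE w0.
  by rewrite /odometer_coord odo_succ_zero w0 odo_succK.
split=> [w /=|w w' _ _ /(can_inj odo_succK)//|u /= u0].
  by rewrite odo_succ_zero.
by exists (odo_pred u); rewrite ?odo_predK//= -odo_succ_zero odo_predK.
Qed.

Lemma sqnorm_odometer_le x : (sqnorm (odometer_coord x) <= sqnorm x)%E.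
Proof.
rewrite sqnorm_odometer_coord (sqnorm_split ord_max x); apply: leeD => //.
exact: esum_convolution_le.
Qed.

Lemma odometer_subproof (x : fock R k.+1) :
  odometer_coord x \in @square_summable R k.+1.
Proof.
apply/square_summableP; apply: le_lt_trans (sqnorm_odometer_le x) _.
exact/square_summableP/coordP.
Qed.

Definition odometer_fun (x : fock R k.+1) : fock R k.+1 :=
  Fock (odometer_subproof x).

Lemma odometer_fun_linear : linear odometer_fun.
Proof.
move=> l x y; apply: fockP => u.
rewrite fockDE fockZE /= /odometer_coord; case: ifP => // _.
rewrite /convolution mulr_sumr -big_split /=; apply: eq_bigr => m _.
rewrite -[X in X * _ = _]/(l * x (nseq m ord_max) + y (nseq m ord_max)).
by rewrite mulrDl mulrA.
Qed.

HB.instance Definition _ := GRing.isLinear.Build R[i] (fock R k.+1)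
  (fock R k.+1) *:%R odometer_fun odometer_fun_linear.

Definition odometer : {linear fock R k.+1 -> fock R k.+1} := odometer_fun.

Lemma odometer_le x : `|odometer x| <= `|x|.
Proof.
rewrite -(@ler_pXn2r _ 2)// ?nnegrE ?normr_ge0// !sqr_fock_norm.
by rewrite lecR -lee_fin !sqnorm_fin ?coordP// sqnorm_odometer_le.
Qed.

(** Finiteness is required only along the powers of [ord_max]; all other coordinates are merely
    permuted. *)
Lemma odometer_finite_isometry (x : fock R k.+1) (M : nat) :
  (forall m, (M <= m)%N -> x (nseq m ord_max) = 0) -> `|odometer x| = `|x|.
Proof.
move=> x0; rewrite -[LHS]/(fock_norm _) -[RHS]/(fock_norm _) /fock_norm.
rewrite sqnorm_odometer_coord (esum_convolution_finite c1 c0 x0).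
rewrite (sqnorm_split ord_max x); congr (Num.sqrt (fine (_ + _)))%:C%C.
rewrite -nneseries_esumT; last by move=> p; exact: normc_sqr_ge0.
rewrite (nneseries_split 0 M); last by move=> p _; exact: normc_sqr_ge0.
rewrite add0n eseries0 ?adde0 ?sumEFin ?big_mkord// => m Mm _.
by rewrite x0// Normc.normc0 expr0n.
Qed.

Lemma odometer_isometry : is_isometry odometer.
Proof.
move=> x; apply/eqP; rewrite eq_le odometer_le /=.
rewrite -[`|x|]/(fock_norm x) -[`|odometer x|]/(fock_norm _) /fock_norm lecR.
apply/ler_addgt0Pr => e e0; rewrite -lecR rmorphD /=.
rewrite -/(fock_norm x) -[X in X + _]/(fock_norm (odometer x)).
rewrite -[fock_norm x]/(`|x|) -[fock_norm _]/(`|odometer x|).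
(* One half pays for replacing [x] by [y], the other for returning from [odometer y] to [odometer x]
   by means of [odometer_le]. *)
have e20 : 0 < e / 2 by rewrite divr_gt0.
have [s xs] := fock_approx x e20; set y := \sum_(w <- s) _ in xs.
have yE : `|odometer y| = `|y|.
  (* Every word of [s] is shorter than this bound, so no power of that length or more occurs in
     [y]. *)
  apply: (@odometer_finite_isometry _ (\max_(w <- s) size w).+1) => m sm.
  rewrite fock_sumE big_seq big1// => w ws; rewrite fockZE fock_basisE.
  case: eqP => [mw|_]; last by rewrite mulr0.
  have := @leq_bigmax_seq _ s xpredT size w ws isT.
  by rewrite -mw size_nseq leqNgt sm.
have -> : e%:C%C = (e / 2)%:C%C + (e / 2)%:C%C :> R[i].
  by rewrite -rmorphD -splitr.
rewrite -[x in leLHS](subrK y) (le_trans (ler_normD _ _))//.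
rewrite addrA addrC lerD ?(ltW xs)// -yE.
rewrite -[y in leLHS](subKr x) linearB (le_trans (ler_normB _ _))//.
by rewrite lerD2l (le_trans (odometer_le _))// ltW.
Qed.

Lemma odometer_basis w : ~~ all (pred1 ord_max) w ->
  odometer (fock_basis w) = fock_basis (odo_succ w).
Proof.
move=> wm; apply: fockP => u.
rewrite -[LHS]/(odometer_coord (fock_basis w) u) /odometer_coord.
rewrite !fock_basisE; case: ifP => u0; last first.
  by rewrite (can2_eq odo_predK odo_succK).
have -> : (u == odo_succ w) = false.
  by apply: contraNF wm => /eqP uw; rewrite -odo_succ_zero -uw.
rewrite /convolution big1// => m _; rewrite fock_basisE.
case: eqP => [mw|_]; last by rewrite mul0r.
by rewrite -mw all_nseq /= eqxx orbT in wm.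
Qed.

Lemma odometer_power m :
  odometer (fock_basis (nseq m ord_max)) = fock_tensor (nseq m ord0) xi.
Proof.
apply: fockP => u; rewrite -[LHS]/(odometer_coord _ u) /odometer_coord.
case: ifPn => [/all_pred1P uE|u0]; last first.
  (* Off the powers of $e_1$ both sides vanish: the predecessor of such a word is not a power of
     $e_n$. *)
  rewrite (tensor_supported _ xi_supported)// fock_basisE.
  case: eqP => // uE; case/negP: u0.
  by rewrite -(odo_predK u) uE odo_succ_zero all_nseq /= eqxx orbT.
rewrite {2}uE tensor_powers_coord.
(* The cutoff [m.+1] makes the only surviving term, of index [m], the last one. *)
rewrite (@convolution_delay _ _ _ m.+1); last first.
  move=> p mp; rewrite fock_basisE (inj_eq (nseq_inj (i := ord_max))).
  by rewrite gtn_eqF.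
rewrite big_ord_recr /= big1 ?add0r => [|p _].
  by rewrite eqxx mul1r.
by rewrite (inj_eq (nseq_inj (i := ord_max))) ltn_eqF// mul0r.
Qed.

Lemma odometerP : is_odometer xi odometer.
Proof.
split.
- by exists 1 => x; rewrite mul1r odometer_le.
(* The vacuum is the power 0, and tensoring by the empty word changes nothing. *)
- rewrite (odometer_power 0); apply: fockP => u.
  by rewrite /= prefix0s drop0.
- by move=> m _; exact: odometer_power.
- move=> j i i' nu ii'; rewrite odometer_basis ?(odo_succ_cat _ _ ii')//.
  rewrite all_cat negb_and /= negb_and -val_eqE /= ltn_eqF ?orbT//.
  by rewrite -ltnS -ii' ltn_ord.
Qed.

End odometer_operator.

Theorem corollary3p2 (R : realType) (k : nat) (xi : fock R k.+1) :
  (exists W : {linear fock R k.+1 -> fock R k.+1},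
      is_odometer xi W /\ is_isometry W)
  <->
  (exists c : nat -> R[i],
    [/\ series (fun p : nat => c p *: fock_basis (nseq p ord0)) @ \oo --> xi,
        series (fun p : nat => `|c p| ^+ 2 : R[i]^o) @ \oo --> (1 : R[i]^o) &
        forall r : nat, (1 <= r)%N ->
          series (fun p : nat => c (p + r)%N * (c p)^*%C : R[i]^o) @ \oo
            --> (0 : R[i]^o)]).
Proof.
split=> [[W [Wxi Wiso]]|[c [cxi c1 c0]]].
  have xi0 := isometric_symbol_supported Wxi Wiso.
  exists (fun p => xi (nseq p ord0)); split.
  - exact: supported_cvg.
  - have := supported_cvg_series xi0.
    by rewrite (isometric_symbol_norm Wxi Wiso).
  - exact: isometric_symbol_autocorrelation Wxi Wiso.
have [cE xi0] := powers_cvg_coord cxi.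
(* The limit determines [c], so its conditions become conditions on the coordinates of [xi], as the
   construction requires. *)
have {}cE : c = (fun p => xi (nseq p ord0)) by apply/funext => p; rewrite cE.
rewrite {}cE in c1 c0.
exists (odometer c1 c0); split; first exact: odometerP.
exact: odometer_isometry.
Qed.
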